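(* Let $d\ge1$, $\sigma\ge2$, $\mathcal I=\mathbb R_{>0}$, $f:\mathbb R^d\to\mathbb R$ smooth, and let $c:=p_0(1)\neq0$ be a real constant. Let $H^{\mathrm Z}$ be the non-autonomous Hamiltonian on $\mathbb R^{2d}\times\mathcal I$ given by $$H^{\mathrm Z}(q,p,t)=-\frac{1}{2c\,t^{2\sigma+1}}\sum_{a=1}^dp_a^2-c\,\sigma^2\,t^{3\sigma-1}f(q^1,\dots,q^d),$$ whose canonical equations of motion yield $\ddot q^a+\frac{2\sigma+1}{t}\dot q^a+\sigma^2t^{\sigma-2}\frac{\partial f}{\partial q^a}=0$, $a=1,\dots,d$. Define transforms of points $(q,p,t)\in\mathbb R^{2d}\times\mathcal I$ by $$\Phi_{X_t,\tau}(q,p,t)=(q,p,t+\tau),$$ $$\Phi_{H_K^{\mathrm Z},\tau}(q,p,t)=(q_\star,p,t),\qquad q_\star^a=q^a+\frac{p_a}{2\sigma c}\left[(t+\tau)^{-2\sigma}-t^{-2\sigma}\right],$$ $$\Phi_{H_V^{\mathrm Z},\tau}(q,p,t)=(q,p^\ast,t),\qquad p^\ast_a=p_a+\frac{\sigma c}{3}\left[(t+\tau)^{3\sigma}-t^{3\sigma}\right]\frac{\partial f}{\partial q^a}(q).$$ Then the maps $$\widetilde\Phi^{1}_{H^{\mathrm Z},\tau}=\Phi_{X_t,\tau/2}\circ\Phi_{H_V^{\mathrm Z},\tau}\circ\Phi_{H_K^{\mathrm Z},\tau}\circ\Phi_{X_t,\tau/2},$$ $$\widetilde\Phi^{2}_{H^{\mathrm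 Z},\tau}=\Phi_{X_t,\tau/2}\circ\Phi_{H_K^{\mathrm Z},\tau/2}\circ\Phi_{H_V^{\mathrm Z},\tau}\circ\Phi_{H_K^{\mathrm Z},\tau/2}\circ\Phi_{X_t,\tau/2}$$ are, respectively, a $1$st order and a $2$nd order (non-autonomous) symplectic integrator for the system with Hamiltonian $H^{\mathrm Z}$.
   Context: The canonical equations of motion of $H^{\mathrm Z}$ are $\dot q^a=\partial H^{\mathrm Z}/\partial p_a$, $\dot p_a=-\partial H^{\mathrm Z}/\partial q^a$, $a=1,\dots,d$. Definition (as in the paper). Let $z(t)=(q(t),p(t))$ be an exact solution of the system with Hamiltonian $H$ and let a one-step algorithm $(z^{(s)}(t),t)\mapsto(z^{(s)}(t+\tau),t+\tau)$ be given. It is called an $s$-th order (non-autonomous) symplectic integrator if: (1) provided $z(t)=z^{(s)}(t)$, the error between $z(t+\tau)$ and $z^{(s)}(t+\tau)$ appears in a $\tau^s$-term of the Taylor expansion in $\tau$ for $|\tau|\ll1$; i.e. the difference contains no terms of order lower than $\tau^s$, so $z(t+\tau)-z^{(s)}(t+\tau)=O(\tau^s)$ as $\tau\to0$; (2) $\omega|_{t+\tau}=\omega|_t$, i.e. for each fixed $t$ and $\tau$ the induced map $z^{(s)}(t)\mapsto z^{(s)}(t+\tau)$ of $\mathbb R^{2d}$ preserves the symplectic form $\omega=\sum_{a=1}^d dp_a\wedge dq^a$. *)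

(* Defs.v *)
From HB Require Import structures.
From mathcomp Require Import all_boot all_order all_algebra.
From mathcomp Require Import all_classical all_reals all_analysis.

Set Implicit Arguments.
Unset Strict Implicit.
Unset Printing Implicit Defensive.

Import Order.TTheory GRing.Theory Num.Theory.
Import numFieldNormedType.Exports.

Local Open Scope classical_set_scope.
Local Open Scope ring_scope.

(* z = (q, p) in R^{2d}: [z.1] is the position, [z.2] the momentum. *)
Notation phase R d := ('rV[R]_d * 'rV[R]_d)%type.

Definition partial (R : realType) (d : nat) (a : 'I_d) (f : 'rV[R]_d -> R)
  : 'rV[R]_d -> R :=
  fun x => 'D_(delta_mx ord0 a) f x.

Definition gradient (R : realType) (d : nat) (f : 'rV[R]_d -> R) (x : 'rV[R]_d)
  : 'rV[R]_d := \row_a partial a f x.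

(* C^infinity: all iterated partial derivatives (the empty iteration being f)
   are Frechet differentiable everywhere. *)
Definition smooth (R : realType) (d : nat) (f : 'rV[R]_d -> R) : Prop :=
  forall (s : seq 'I_d) (x : 'rV[R]_d),
    differentiable (foldr (@partial R d) f s) x.

(* omega = sum_a dp_a /\ dq^a, with (alpha /\ beta)(u, v) =
   alpha(u) beta(v) - alpha(v) beta(u). *)
Definition omega (R : realType) (d : nat) (u v : phase R d) : R :=
  \sum_(a < d) (u.2 ord0 a * v.1 ord0 a - v.2 ord0 a * u.1 ord0 a).

(* The pullback of omega by F is omega. *)
Definition preserves_omega (R : realType) (d : nat)
    (F : phase R d -> phase R d) : Prop :=
  forall z : phase R d,
    differentiable F z /\
    forall u v : phase R d,
      omega ('d F z u) ('d F z v) = omega u v.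

Definition canonical_solution (R : realType) (d : nat)
    (H : phase R d -> R -> R) (J : set R) (z : R -> phase R d) : Prop :=
  forall t : R, J t -> forall a : 'I_d,
    is_derive t (1 : R) (fun s => (z s).1 ord0 a)
      (partial a (fun p => H ((z t).1, p) t) (z t).2) /\
    is_derive t (1 : R) (fun s => (z s).2 ord0 a)
      (- partial a (fun q => H (q, (z t).2) t) (z t).1).

(* [alg tau] maps (z, t) to (z', t + tau).  Exact solutions need not exist on
   all of [I], so the local error is estimated along solutions on any open
   subinterval; [tau] may have either sign. *)
Definition symplectic_integrator (R : realType) (d : nat) (s : nat)
    (I : set R) (H : phase R d -> R -> R)
    (alg : R -> phase R d * R -> phase R d * R) : Prop :=
  [/\ forall (t tau : R) (z : phase R d), I t -> I (t + tau) ->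
        (alg tau (z, t)).2 = t + tau,
      forall (J : set R) (z : R -> phase R d),
        open J -> is_interval J -> J `<=` I ->
        canonical_solution H J z ->
        forall t : R, J t ->
          (fun tau : R => z (t + tau) - (alg tau (z t, t)).1)
            =O_ (nbhs (0 : R)) (fun tau : R => tau ^+ s)
    & forall t tau : R, I t -> I (t + tau) ->
        preserves_omega (fun z => (alg tau (z, t)).1)].

Definition HZ (R : realType) (d : nat) (sigma c : R) (f : 'rV[R]_d -> R)
    (z : phase R d) (t : R) : R :=
  - (1 / (2 * c * t `^ (2 * sigma + 1))) * (\sum_(a < d) z.2 ord0 a ^+ 2)
  - c * sigma ^+ 2 * t `^ (3 * sigma - 1) * f z.1.

(* The transforms act on points (q, p, t); the time component is left in all
   of R, with [`^] taking its default value at nonpositive base. *)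
Definition Phi_X (R : realType) (d : nat) (tau : R) (x : phase R d * R)
  : phase R d * R :=
  let: (q, p, t) := x in (q, p, t + tau).

Definition Phi_K (R : realType) (d : nat) (sigma c tau : R)
    (x : phase R d * R) : phase R d * R :=
  let: (q, p, t) := x in
  (q + (((t + tau) `^ (- (2 * sigma)) - t `^ (- (2 * sigma)))
          / (2 * sigma * c)) *: p, p, t).

Definition Phi_V (R : realType) (d : nat) (sigma c : R) (f : 'rV[R]_d -> R)
    (tau : R) (x : phase R d * R) : phase R d * R :=
  let: (q, p, t) := x in
  (q, p + (sigma * c / 3 * ((t + tau) `^ (3 * sigma) - t `^ (3 * sigma)))
            *: gradient f q, t).

Definition Phi1 (R : realType) (d : nat) (sigma c : R) (f : 'rV[R]_d -> R)
    (tau : R) : phase R d * R -> phase R d * R :=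
  @Phi_X R d (tau / 2) \o Phi_V sigma c f tau \o Phi_K sigma c tau
    \o @Phi_X R d (tau / 2).

Definition Phi2 (R : realType) (d : nat) (sigma c : R) (f : 'rV[R]_d -> R)
    (tau : R) : phase R d * R -> phase R d * R :=
  @Phi_X R d (tau / 2) \o Phi_K sigma c (tau / 2) \o Phi_V sigma c f tau
    \o Phi_K sigma c (tau / 2) \o @Phi_X R d (tau / 2).

(* Main.v *)
(** A drift [(q, p) |-> (q + k p, p)] is linear and symplectic, and a kick
    [(q, p) |-> (q, p + v grad f q)] is symplectic because the Hessian of [f]
    is symmetric; at fixed [t] and [tau] both splittings are composites of
    drifts and kicks.  Along a solution [q' = K(t) p] and
    [p' = V(t) grad f q], where [K], [V] are differentiable; hence [q'] and [p']
    are again differentiable and the mean value theorem gives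
    [z(t + tau) = z(t) + tau z'(t) + O(tau^2)].  The drift and kick
    coefficients are increments of primitives of [K] and [V], so the splittings
    have the same first-order expansion; the error is [O(tau^2)] for both. *)

Require Import Defs.
From HB Require Import structures.
From mathcomp Require Import all_boot all_order all_algebra.
From mathcomp Require Import all_classical all_reals all_analysis.
From mathcomp Require Import ring.
Import Order.TTheory GRing.Theory Num.Theory.
Import numFieldNormedType.Exports.
Local Open Scope classical_set_scope.
Local Open Scope ring_scope.

Set Implicit Arguments.
Unset Strict Implicit.
Unset Printing Implicit Defensive.

(** * Symmetry of mixed second derivatives *)

Lemma differentiable_remainder (R : realType) (V W : normedModType R)
    (g : V -> W) (x : V) (e : R) : differentiable g x -> 0 < e ->
  exists2 delta : R, 0 < delta & forall h : V, `|h| < delta ->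
    `|g (x + h) - g x - 'd g x h| <= e * `|h|.
Proof.
move=> /diff_locallyP[_ gE] e0.
have /eqaddoP := gE => /(_ e e0).
move=> /nbhs_ballP[delta /= delta0 H].
exists delta => // h hd.
rewrite -addrA -opprD [x + h]addrC; apply: (H h).
by rewrite -ball_normE /= sub0r normrN.
Qed.

(** Turns a directional derivative into a derivative in one real variable, the form to which the
    mean value theorem applies. *)
Lemma is_derive_line (R : realType) (V W : normedModType R)
    (g : V -> W) (u w : V) (s : R) : differentiable g (s *: u + w) ->
  is_derive s (1 : R) (fun r : R => g (r *: u + w)) ('D_u g (s *: u + w)).
Proof.
move=> dg.
have dl : is_diff s (fun r : R => r *: u + w) (fun r : R => r *: u).
  have := is_diffD (is_diff_scalel s u) (is_diff_cst w s).
  by rewrite addr0.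
have dgl : differentiable (g \o (fun r : R => r *: u + w)) s.
  exact: differentiable_comp.
apply: DeriveDef; first exact: diff_derivable.
rewrite deriveE // diff_comp //= deriveE //.
by rewrite diff_val scale1r.
Qed.

(* The mean value theorem in the direction [u], applied to the increment of [g]
   in the direction [h v], then the expansion of ['D_u g] at [x]. *)
Lemma second_difference (R : realType) (V : normedModType R) (g : V -> R)
    (u v x : V) (e : R) : (forall y, differentiable g y) ->
  differentiable ('D_u g) x -> 0 < e ->
  \forall h \near 0^'+,
    `|g (h *: u + (x + h *: v)) - g (h *: u + x) - g (x + h *: v) + g x
      - h ^+ 2 * 'D_v ('D_u g) x| <= e * h ^+ 2.
Proof.
move=> dg ddg e0.
(* Both increments evaluated below, [xi *: u] and [xi *: u + h *: v] with [0 < xi < h], have norm at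
   most [h * M]; the summand 1 keeps [M] positive when [u = v = 0]. *)
set M := `|u| + `|v| + 1.
have M0 : 0 < M by rewrite ltr_wpDl // addr_ge0.
(* Two remainders will each contribute [e / 2 * h]. *)
have eM : 0 < e / (2 * M) by rewrite divr_gt0 // mulr_gt0.
have [delta delta0 rem] := differentiable_remainder ddg eM.
near=> h.
have h0 : 0 < h by near: h; exact: nbhs_right_gt.
have hM : h * M < delta.
  rewrite -ltr_pdivlMr //; near: h; apply: nbhs_right_lt.
  by rewrite divr_gt0.
set phi := fun s : R => g (s *: u + (x + h *: v)) - g (s *: u + x).
set dphi := fun s : R =>
  'D_u g (s *: u + (x + h *: v)) - 'D_u g (s *: u + x).
have phi' s : is_derive s (1 : R) phi (dphi s).
  by apply: is_deriveB; exact: is_derive_line.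
have cphi : {within `[0, h], continuous phi}.
  apply: derivable_within_continuous => s _.
  by have [] := phi' s.
have [xi] := MVT h0 (fun s _ => phi' s) cphi.
rewrite in_itv /= => /andP[xi0 xih].
rewrite /phi !scale0r !add0r subr0 => mvt.
have -> : g (h *: u + (x + h *: v)) - g (h *: u + x) - g (x + h *: v) + g x
    = dphi xi * h by rewrite -mvt; ring.
have small w : `|w| <= h * M -> `|'D_u g (x + w) - 'D_u g x
    - 'd ('D_u g) x w| <= e / 2 * h.
  move=> wM; apply: le_trans (rem _ (le_lt_trans wM hM)) _.
  apply: le_trans (ler_wpM2l (ltW eM) wM) _.
  rewrite le_eqVlt; apply/orP; left; apply/eqP; field.
  exact: lt0r_neq0.
have xiu : `|xi *: u| <= h * `|u|.
  by rewrite normrZ (gtr0_norm xi0) ler_wpM2r // ltW.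
have hv : `|h *: v| = h * `|v| by rewrite normrZ (gtr0_norm h0).
have s1 : `|xi *: u| <= h * M.
  apply: le_trans xiu _; rewrite ler_wpM2l ?(ltW h0) // /M -addrA lerDl.
  by rewrite addr_ge0.
have s2 : `|xi *: u + h *: v| <= h * M.
  apply: le_trans (ler_normD _ _) _; rewrite hv.
  apply: le_trans (lerD xiu (lexx _)) _.
  by rewrite -mulrDr ler_wpM2l ?(ltW h0) // /M lerDl.
have {s1} := small _ s1; have {s2} := small _ s2.
have dZ a w : 'd ('D_u g) x (a *: w) = a *: 'd ('D_u g) x w.
  exact: linearZ.
rewrite linearD !dZ => s2 s1.
rewrite deriveE //.
(* The unknown point [xi] enters both expansions at [x] through the same linear term, which cancels;
   only the [h *: v] term and the two remainders survive. *)
have -> : dphi xi * h - h ^+ 2 * 'd ('D_u g) x v =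
  ((('D_u g (x + (xi *: u + h *: v)) - 'D_u g x) -
      (xi *: 'd ('D_u g) x u + h *: 'd ('D_u g) x v))
   - ('D_u g (x + xi *: u) - 'D_u g x - xi *: 'd ('D_u g) x u)) * h.
  rewrite /dphi [xi *: u + (x + _)]addrCA [xi *: u + x]addrC.
  rewrite /GRing.scale /=; ring.
rewrite normrM (gtr0_norm h0) expr2 mulrA ler_wpM2r ?(ltW h0) //.
apply: le_trans (ler_normB _ _) _.
apply: le_trans (lerD s2 s1) _.
by rewrite -mulrDl -splitr.
Unshelve. all: by end_near. Qed.

(** The second difference is symmetric in [u] and [v], so [h ^+ 2] times either mixed derivative
    approximates the same quantity up to [e / 2 * h ^+ 2]; dividing by [h ^+ 2] leaves a difference
    of at most [e]. *)
Lemma derive_commute (R : realType) (V : normedModType R) (g : V -> R)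
    (u v x : V) : (forall y, differentiable g y) ->
  differentiable ('D_u g) x -> differentiable ('D_v g) x ->
  'D_v ('D_u g) x = 'D_u ('D_v g) x.
Proof.
move=> dg du dv; apply/eqP; rewrite -subr_eq0 -normr_le0.
apply/ler_addgt0Pl => e e0; rewrite addr0.
have e2 : 0 < e / 2 by rewrite divr_gt0.
have H1 := second_difference v dg du e2.
have H2 := second_difference u dg dv e2.
have [h [[h0 {}H1] {}H2]] :=
  filter_ex (filterI (filterI (nbhs_right_gt (0 : R)) H1) H2).
have h20 : 0 < h ^+ 2 by rewrite exprn_gt0.
rewrite -(ler_pM2r h20) -{1}(gtr0_norm h20) -normrM.
(* Generalizing keeps [ring] from comparing the two derivatives by conversion. *)
move: H1 H2; move: ('D_v _ x) ('D_u _ x) => P Q.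
rewrite [h *: v + (x + _)]addrCA [h *: v + x]addrC [h *: v + h *: u]addrC.
rewrite [x + h *: u]addrC [h *: u + (x + _)]addrCA.
set A := _ - _ - _ + g x; set B := _ - _ - _ + g x => H1 H2.
have AB : A = B by rewrite /A /B; ring.
have -> : (P - Q) * h ^+ 2 = (B - h ^+ 2 * Q) - (A - h ^+ 2 * P).
  by rewrite AB; ring.
apply: le_trans (ler_normB _ _) _.
apply: le_trans (lerD H2 H1) _.
by rewrite -mulrDl -splitr.
Qed.

(** * First-order Taylor expansion *)

(** The mean value theorem gives [g (t + h) - g t = dg xi * h] with [xi] within [|h|] of [t], and
    differentiability of [dg] at the single point [t] bounds [dg xi - dg t] linearly in [h]. The
    factor [a] allows for fractional steps. *)
Lemma taylor1_bigO (R : realType) (g dg : R -> R) (t a : R) :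
  (\forall s \near t, is_derive s (1 : R) g (dg s)) -> derivable dg t 1 ->
  (fun tau : R => g (t + a * tau) - g t - a * tau * dg t)
    =O_ (nbhs (0 : R)) (fun tau : R => tau ^+ 2).
Proof.
move=> gd /derivable1_diffP ddg.
have [delta1 delta10 H1] := differentiable_remainder ddg ltr01.
move: gd => /nbhs_ballP[delta2 /= delta20 H2].
(* The 1 is the remainder of [dg] at tolerance 1, the other summand the size of its derivative. *)
set C := 1 + `|'d dg t 1|.
have C0 : 0 < C by rewrite ltr_pwDl.
have lip h : `|h| < delta1 -> `|dg (t + h) - dg t| <= C * `|h|.
  move=> /H1; rewrite mul1r => H.
  have -> : dg (t + h) - dg t = (dg (t + h) - dg t - 'd dg t h) + 'd dg t h.
    by rewrite subrK.
  apply: le_trans (ler_normD _ _) _; rewrite /C mulrDl mul1r lerD //.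
  by rewrite -{1}[h]mulr1 -[h * 1]/(h *: 1) linearZ normrZ mulrC.
have main h : `|h| < delta1 -> `|h| < delta2 ->
    `|g (t + h) - g t - h * dg t| <= C * `|h| ^+ 2.
  move=> h1 h2.
  have drv s : `|s - t| <= `|h| -> is_derive s (1 : R) g (dg s).
    move=> sh; apply: H2; rewrite -ball_normE /= distrC.
    exact: le_lt_trans sh h2.
  suff [xi xih mvt] : exists2 xi, `|xi - t| <= `|h| &
      g (t + h) - g t = dg xi * h.
    rewrite mvt [h * _]mulrC -mulrBl normrM expr2 mulrA ler_wpM2r //.
    have := lip (xi - t) (le_lt_trans xih h1).
    rewrite [t + (xi - t)]addrC subrK => H.
    by apply: le_trans H _; rewrite ler_wpM2l // ltW.
  (* The mean value theorem wants ordered endpoints, while the step may have either sign. *)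
  have [h0|h0|->] := ltgtP h 0; last first.
  - exists t; first by rewrite subrr normr0.
    by rewrite addr0 subrr mulr0.
  - have tth : t < t + h by rewrite ltrDl.
    have drvI s : s \in `[t, t + h] -> is_derive s (1 : R) g (dg s).
      rewrite in_itv /= => /andP[ts sth]; apply: drv.
      by rewrite (gtr0_norm h0) ger0_norm ?subr_ge0 // lerBlDl.
    have drvo s : s \in `]t, t + h[ -> is_derive s (1 : R) g (dg s).
      by move=> sI; apply: drvI; exact: subset_itv_oo_cc.
    have cg : {within `[t, t + h], continuous g}.
      by apply: derivable_within_continuous => s sI; have [] := drvI s sI.
    have [xi xiI ->] := MVT tth drvo cg.
    exists xi;
      last by rewrite addrAC subrr add0r.
    move: xiI; rewrite in_itv /= => /andP[ts sth].
      by rewrite (gtr0_norm h0) ger0_norm ?subr_ge0 ?(ltW ts) // lerBlDl ltW.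
  - have tth : t + h < t by rewrite gtrDl.
    have drvI s : s \in `[t + h, t] -> is_derive s (1 : R) g (dg s).
      rewrite in_itv /= => /andP[ts sth]; apply: drv.
      rewrite (ltr0_norm h0) ler0_norm ?subr_le0 //.
      by rewrite opprB lerBlDl -lerBlDr opprK.
    have drvo s : s \in `]t + h, t[ -> is_derive s (1 : R) g (dg s).
      by move=> sI; apply: drvI; exact: subset_itv_oo_cc.
    have cg : {within `[t + h, t], continuous g}.
      by apply: derivable_within_continuous => s sI; have [] := drvI s sI.
    have [xi xiI mvt] := MVT tth drvo cg.
    exists xi.
      move: xiI; rewrite in_itv /= => /andP[ts sth].
        rewrite (ltr0_norm h0) ler0_norm ?subr_le0 ?(ltW sth) //.
        by rewrite opprB lerBlDl -lerBlDr opprK ltW.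
      by rewrite -opprB mvt; ring.
(* From [|a * tau| <= (|a| + 1) * |tau|]; adding 1 keeps the constant positive when [a = 0]. *)
apply/eqO_exP; exists (C * (`|a| + 1) ^+ 2).
  by rewrite mulr_gt0 // exprn_gt0 // ltr_wpDl.
have a0 : 0 < `|a| + 1 by rewrite ltr_wpDl.
have near_lt e : 0 < e -> \forall tau \near (0 : R), `|tau| < e / (`|a| + 1).
  by move=> e0; apply: nbhs0_lt; rewrite divr_gt0.
near=> tau.
have at1 : `|a * tau| <= (`|a| + 1) * `|tau|.
  by rewrite normrM ler_wpM2r // lerDl.
have td1 : (`|a| + 1) * `|tau| < delta1.
  by rewrite mulrC -ltr_pdivlMr //; near: tau; exact: near_lt.
have td2 : (`|a| + 1) * `|tau| < delta2.
  by rewrite mulrC -ltr_pdivlMr //; near: tau; exact: near_lt.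
apply: le_trans (main _ (le_lt_trans at1 td1) (le_lt_trans at1 td2)) _.
rewrite -mulrA ler_wpM2l ?(ltW C0) // normrX -exprMn.
by rewrite lerXn2r // nnegrE // mulr_ge0 // ltW.
Unshelve. all: by end_near. Qed.

(** * Symplectic drifts and kicks *)

Global Instance is_diff_fst (R : realType) (V W : normedModType R) (x : V * W) :
  is_diff x fst fst.
Proof.
have cont : continuous (fst : V * W -> V) by move=> y; exact: cvg_fst.
by apply: DiffDef; [exact: linear_differentiable|exact: diff_lin].
Qed.

Global Instance is_diff_snd (R : realType) (V W : normedModType R) (x : V * W) :
  is_diff x snd snd.
Proof.
have cont : continuous (snd : V * W -> W) by move=> y; exact: cvg_snd.
by apply: DiffDef; [exact: linear_differentiable|exact: diff_lin].
Qed.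

Lemma is_diff_sum (R : realType) (V W : normedModType R) (n : nat)
    (F dF : 'I_n -> V -> W) (x : V) : (forall i, is_diff x (F i) (dF i)) ->
  is_diff x (fun y => \sum_(i < n) F i y) (fun y => \sum_(i < n) dF i y).
Proof.
move=> FdF.
have -> : (fun y => \sum_(i < n) F i y) = \sum_(i < n) F i.
  by apply/funext => y; rewrite fct_sumE.
have -> : (fun y => \sum_(i < n) dF i y) = \sum_(i < n) dF i.
  by apply/funext => y; rewrite fct_sumE.
elim/big_ind2 : _ => [|f df g dg fdf gdg|i _]; last exact: FdF.
  exact: (is_diff_cst 0 x).
exact: is_diffD.
Qed.

(** In the standard basis the gradient is a sum of scalar functions times fixed vectors, so the
    scalar rules suffice; the differential is the Hessian applied to [u]. *)
Lemma is_diff_gradient (R : realType) (d : nat) (f : 'rV[R]_d -> R)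
    (x : 'rV[R]_d) : (forall a, differentiable (partial a f) x) ->
  is_diff x (gradient f) (fun u => \row_a 'd (partial a f) x u).
Proof.
move=> df.
have -> : gradient f = fun y => \sum_(a < d) partial a f y *: delta_mx 0 a.
  apply/funext => y; rewrite [LHS]row_sum_delta.
  by apply: eq_bigr => a _; rewrite mxE.
have -> : (fun u => \row_a 'd (partial a f) x u) =
    fun u => \sum_(a < d) 'd (partial a f) x u *: delta_mx 0 a.
  apply/funext => u; rewrite [LHS]row_sum_delta.
  by apply: eq_bigr => a _; rewrite mxE.
apply: is_diff_sum => a.
have dpa := differentiableP (df a).
exact: (is_diff_comp dpa (is_diff_scalel (partial a f x) (delta_mx 0 a))).
Qed.

Lemma smooth_differentiable (R : realType) (d : nat) (f : 'rV[R]_d -> R) x :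
  smooth f -> differentiable f x.
Proof. by move=> /(_ [::] x). Qed.

(** In [foldr] the last index of the sequence is the innermost derivative, hence [rcons]. *)
Lemma smooth_partial (R : realType) (d : nat) (f : 'rV[R]_d -> R) (a : 'I_d) :
  smooth f -> smooth (partial a f).
Proof. by move=> fs s x; have := fs (rcons s a) x; rewrite foldr_rcons. Qed.

Lemma diff_partialE (R : realType) (d : nat) (f : 'rV[R]_d -> R) x u :
  differentiable f x -> 'd f x u = \sum_(a < d) u ord0 a * partial a f x.
Proof.
move=> df; rewrite {1}[u]row_sum_delta linear_sum /=; apply: eq_bigr => a _.
by rewrite linearZ /= /partial deriveE.
Qed.

(** Both sides are the Hessian bilinear form: expand in coordinates, exchange the two sums and
    commute the partial derivatives. *)
Lemma hessian_symmetric (R : realType) (d : nat) (f : 'rV[R]_d -> R)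
    (x u v : 'rV[R]_d) : smooth f ->
  \sum_(a < d) 'd (partial a f) x u * v ord0 a =
  \sum_(a < d) 'd (partial a f) x v * u ord0 a.
Proof.
move=> fs.
have dp a y : differentiable (partial a f) y.
  exact/smooth_differentiable/smooth_partial.
transitivity (\sum_(a < d) \sum_(b < d)
    u ord0 b * partial b (partial a f) x * v ord0 a).
  by apply: eq_bigr => a _; rewrite diff_partialE // mulr_suml.
rewrite exchange_big /=; apply: eq_bigr => a _.
rewrite diff_partialE // mulr_suml; apply: eq_bigr => b _.
have -> : partial a (partial b f) x = partial b (partial a f) x.
  rewrite /partial; apply: derive_commute => [y||]; last exact: dp.
    exact: smooth_differentiable.
  exact: dp.
by rewrite mulrC mulrA mulrAC.
Qed.

Lemma preserves_omega_comp (R : realType) (d : nat)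
    (F G : phase R d -> phase R d) :
  preserves_omega F -> preserves_omega G -> preserves_omega (G \o F).
Proof.
move=> pF pG z.
have [dF oF] := pF z; have [dG oG] := pG (F z).
split=> [|u v]; first exact: differentiable_comp.
have E w : 'd (G \o F) z w = 'd G (F z) ('d F z w).
  exact: (congr1 (@^~ w) (diff_comp dF dG)).
apply: eq_trans (congr2 (@omega R d) (E u) (E v)) _.
by apply: eq_trans (oF u v); exact: oG.
Qed.

Definition drift (R : realType) (d : nat) (k : R) (z : phase R d) : phase R d :=
  (z.1 + k *: z.2, z.2).

Definition kick (R : realType) (d : nat) (f : 'rV[R]_d -> R) (v : R)
    (z : phase R d) : phase R d := (z.1, z.2 + v *: gradient f z.1).

Lemma preserves_omega_drift (R : realType) (d : nat) (k : R) :
  preserves_omega (@drift R d k).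
Proof.
move=> z.
have dz : is_diff z (@drift R d k) (@drift R d k).
  exact: (is_diff_pair (is_diffD (is_diff_fst z) (is_diffZ k (is_diff_snd z)))
    (is_diff_snd z)).
split=> // u v; rewrite diff_val /omega /drift /=.
(* The terms added by the drift are [k] times a product of momentum components of [u] and [v],
   symmetric in the two vectors, so they cancel in each summand. *)
by apply: eq_bigr => a _; rewrite !mxE; ring.
Qed.

Lemma preserves_omega_kick (R : realType) (d : nat) (f : 'rV[R]_d -> R) (v : R) :
  smooth f -> preserves_omega (kick f v).
Proof.
move=> fs z.
have dg : is_diff (z.1) (gradient f) (fun u => \row_a 'd (partial a f) (z.1) u).
  by apply: is_diff_gradient => a; exact/smooth_differentiable/smooth_partial.
have dz : is_diff z (kick f v) (fun u =>
    (u.1, u.2 + v *: \row_a 'd (partial a f) (z.1) u.1)).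
  exact: (is_diff_pair (is_diff_fst z)
    (is_diffD (is_diff_snd z) (is_diffZ v (is_diff_comp (is_diff_fst z) dg)))).
split=> // u w; rewrite diff_val /omega /=.
apply/eqP; rewrite -subr_eq0 -sumrB; apply/eqP.
under eq_bigr => a _ do rewrite !mxE.
(* Here the cancellation is not coordinatewise: it appears only after summation, as the symmetry of
   the Hessian. *)
transitivity (v * (\sum_(a < d) 'd (partial a f) (z.1) u.1 * w.1 ord0 a
    - \sum_(a < d) 'd (partial a f) (z.1) w.1 * u.1 ord0 a)).
  rewrite -sumrB mulr_sumr; apply: eq_bigr => a _.
  by move: ('d _ _ u.1) ('d _ _ w.1) => P Q; ring.
by rewrite hessian_symmetric // subrr mulr0.
Qed.

(** * The canonical equations *)

Lemma is_derive_coord (R : realType) (m n : nat) (M N : 'M[R]_(m, n)) i j :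
  is_derive M N (fun P : 'M[R]_(m, n) => P i j) (N i j).
Proof.
apply: DeriveDef; first exact/diff_derivable/differentiable_coord.
have dM : derivable (id : 'M[R]_(m, n) -> _) M N by exact: derivable_id.
have := derive_mx dM.
by rewrite derive_id => /matrixP/(_ i j); rewrite mxE => ->.
Qed.

(** The shape of [HZ] as a function of the momentum: the potential term is the constant [B]. *)
Lemma partial_sum_sqr (R : realType) (d : nat) (a : 'I_d) (A B : R)
    (p : 'rV[R]_d) :
  partial a (fun p => A * (\sum_(b < d) p ord0 b ^+ 2) - B) p
    = A * (2 * p ord0 a).
Proof.
have dsq (b : 'I_d) : is_derive p (delta_mx ord0 a)
    (fun x : 'rV[R]_d => x ord0 b ^+ 2) (2 * p ord0 b * (b == a)%:R).
  have dc := is_derive_coord p (delta_mx ord0 a) ord0 b.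
  have -> : (fun x : 'rV[R]_d => x ord0 b ^+ 2) =
    (fun x : 'rV[R]_d => x ord0 b) * (fun x : 'rV[R]_d => x ord0 b) by [].
  apply: (is_derive_eq (is_deriveM dc dc)).
  by rewrite mxE eqxx /GRing.scale /=; ring.
have dS : is_derive p (delta_mx ord0 a)
    (fun x : 'rV[R]_d => \sum_(b < d) x ord0 b ^+ 2) (2 * p ord0 a).
  have -> : (fun x : 'rV[R]_d => \sum_(b < d) x ord0 b ^+ 2) =
      \sum_(b < d) (fun x : 'rV[R]_d => x ord0 b ^+ 2).
    by apply/funext => x; rewrite fct_sumE.
  apply: (is_derive_eq (is_derive_sum dsq)).
  rewrite (bigD1 a) //= eqxx mulr1 big1 ?addr0 // => b /negPf ->.
  by rewrite mulr0.
rewrite /partial.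
have := is_deriveB (is_deriveZ A dS) (is_derive_cst B p (delta_mx ord0 a)).
by rewrite subr0 => /@derive_val.
Qed.

(** The shape of [HZ] as a function of the position: the kinetic term is the constant [A]. *)
Lemma partial_affine (R : realType) (d : nat) (a : 'I_d) (A B : R)
    (f : 'rV[R]_d -> R) (q : 'rV[R]_d) : differentiable f q ->
  partial a (fun q => A - B * f q) q = - (B * partial a f q).
Proof.
move=> /(@diff_derivable _ _ _ _ _ (delta_mx ord0 a))/derivableP df.
have := is_deriveB (is_derive_cst A q (delta_mx ord0 a)) (is_deriveZ B df).
by rewrite sub0r => /@derive_val.
Qed.

(** The coefficient K(t) in [q' = K(t) p]; [kick_rate] is V(t) in [p' = V(t) grad f q]. *)
Definition drift_rate (R : realType) (sigma c t : R) : R :=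
  - (t `^ (- (2 * sigma + 1)) / c).

Definition kick_rate (R : realType) (sigma c t : R) : R :=
  c * sigma ^+ 2 * t `^ (3 * sigma - 1).

Lemma canonical_solution_HZ (R : realType) (d : nat) (sigma c : R)
    (f : 'rV[R]_d -> R) (J : set R) (z : R -> phase R d) :
  c != 0 -> (forall x, differentiable f x) -> J `<=` [set t | 0 < t] ->
  canonical_solution (HZ sigma c f) J z -> forall t, J t -> forall a : 'I_d,
  is_derive t (1 : R) (fun s => (z s).1 ord0 a)
    (drift_rate sigma c t * (z t).2 ord0 a) /\
  is_derive t (1 : R) (fun s => (z s).2 ord0 a)
    (kick_rate sigma c t * partial a f (z t).1).
Proof.
move=> c0 df J0 sol t Jt a; have t0 : 0 < t := J0 t Jt.
have [dq dp] := sol t Jt a; split.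
  apply: (is_derive_eq dq).
  rewrite /HZ /= partial_sum_sqr /drift_rate powRN.
  have : t `^ (2 * sigma + 1) != 0 by rewrite powR_eq0 gt_eqF.
  by move: (t `^ _) ((z t).2 ord0 a) => x y x0; field; rewrite c0.
apply: (is_derive_eq dp).
by rewrite /HZ /= partial_affine // opprK.
Qed.

Lemma is_derive_drift_primitive (R : realType) (sigma c t : R) :
  c != 0 -> sigma != 0 -> 0 < t ->
  is_derive t (1 : R) (fun s => s `^ (- (2 * sigma)) / (2 * sigma * c))
    (drift_rate sigma c t).
Proof.
move=> c0 s0 t0.
have dpow := is_derive1_powR (- (2 * sigma)) t0.
have := is_deriveZ (2 * sigma * c)^-1 dpow.
have -> : (2 * sigma * c)^-1 \*: (@powR R ^~ (- (2 * sigma)))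
    = (fun s => s `^ (- (2 * sigma)) / (2 * sigma * c)).
  by apply/funext => s; rewrite [RHS]mulrC.
move=> H; apply: (is_derive_eq H).
have -> : - (2 * sigma) - 1 = - (2 * sigma + 1) by rewrite opprD.
rewrite /drift_rate /GRing.scale /=.
by move: (t `^ _) => x; field; rewrite c0 s0.
Qed.

Lemma is_derive_kick_primitive (R : realType) (sigma c t : R) : 0 < t ->
  is_derive t (1 : R) (fun s => sigma * c / 3 * s `^ (3 * sigma))
    (kick_rate sigma c t).
Proof.
move=> t0.
apply: (is_derive_eq (is_deriveZ (sigma * c / 3)
  (is_derive1_powR (3 * sigma) t0))).
rewrite /kick_rate /GRing.scale /=.
by move: (t `^ _) => x; field.
Qed.

(** Expressed as a multiple of the rate itself, because the factor [(2 * sigma + 1) / t] becomes the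
    damping coefficient of the second-order equation. *)
Lemma is_derive_drift_rate (R : realType) (sigma c t : R) : 0 < t ->
  is_derive t (1 : R) (drift_rate sigma c)
    (- ((2 * sigma + 1) / t * drift_rate sigma c t)).
Proof.
move=> t0.
have := is_deriveZ (- c^-1) (is_derive1_powR (- (2 * sigma + 1)) t0).
have -> : - c^-1 \*: (@powR R ^~ (- (2 * sigma + 1))) = drift_rate sigma c.
  by apply/funext => s; rewrite /drift_rate [in RHS]mulrC -mulNr.
move=> H; apply: (is_derive_eq H).
have -> : t `^ (- (2 * sigma + 1) - 1) = t `^ (- (2 * sigma + 1)) / t.
  by rewrite powRB ?powRr1 ?(ltW t0) // (gt_eqF t0) implybT.
rewrite /drift_rate /GRing.scale /=.
by move: (t `^ _) (c^-1) (t^-1) => x y w; ring.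
Qed.

Lemma derivable_kick_rate (R : realType) (sigma c t : R) : 0 < t ->
  derivable (kick_rate sigma c) t 1.
Proof.
move=> t0; apply: derivableZ.
by have [] := is_derive1_powR (3 * sigma - 1) t0.
Qed.

(** * The equations of motion in second-order form *)

Section second_order_equation.
Context (R : realType) (d : nat) (sigma c : R) (f : 'rV[R]_d -> R).
Context (J : set R) (z : R -> phase R d).
Hypotheses (c_neq0 : c != 0) (f_smooth : smooth f).
Hypotheses (J_open : open J) (J_gt0 : J `<=` [set t | 0 < t]).
Hypothesis sol : canonical_solution (HZ sigma c f) J z.

Let eqs := canonical_solution_HZ c_neq0
  (fun x => smooth_differentiable x f_smooth) J_gt0 sol.

(** Differentiate [q' = K p]: the term [K' p] is the damping [- (2 * sigma + 1) / t * q'], and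
    [K p' = K V grad f] is the force. *)
Lemma second_order_equation (a : 'I_d) (t : R) : J t ->
  let q_a : R -> R := fun s => (z s).1 ord0 a in
  derivable (q_a^`()%classic) t 1 /\
  (q_a^`()^`()%classic) t + (2 * sigma + 1) / t * (q_a^`()%classic) t
    + sigma ^+ 2 * t `^ (sigma - 2) * partial a f (z t).1 = 0.
Proof.
move=> Jt q_a; have t0 : 0 < t := J_gt0 Jt.
have q'E s : J s -> (q_a^`()%classic) s = drift_rate sigma c s * (z s).2 ord0 a.
  by move=> Js; rewrite derive1E; have [/@derive_val ->] := eqs Js a.
(* Differentiating [q' = K p] needs the identity on a neighbourhood of [t], supplied by the openness
   of [J]. *)
have q'N : \forall s \near t,
    drift_rate sigma c s * (z s).2 ord0 a = (q_a^`()%classic) s.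
  by near=> s; rewrite q'E //; near: s; exact: open_nbhs_nbhs.
have [_ dp] := eqs Jt a.
have dr := is_derive_drift_rate sigma c t0.
have q'' := near_eq_is_derive q'N (is_deriveM dr dp).
split; first by have [] := q''.
rewrite [X in X + _ + _]derive1E (@derive_val _ _ _ _ _ _ _ q'') q'E //.
(* In the product K V the constant [c] cancels and the exponents add up to [sigma - 2]. *)
have tk : drift_rate sigma c t * kick_rate sigma c t =
    - (sigma ^+ 2 * t `^ (sigma - 2)).
  have -> : sigma - 2 = - (2 * sigma + 1) + (3 * sigma - 1) by ring.
  rewrite /drift_rate /kick_rate [in RHS]powRD; last by rewrite (gt_eqF t0) implybT.
  by field; exact: c_neq0.
rewrite /GRing.scale /= [drift_rate _ _ _ * (_ * _)]mulrA tk.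
by move: (t `^ _) (drift_rate _ _ _) (partial _ _ _) => x y w; ring.
Unshelve. all: by end_near. Qed.

End second_order_equation.

(** * Local errors *)

Section bigO_algebra.
Context (R : realType).
Implicit Types (g h : R -> R) (n : nat).

Lemma eqO_add g1 g2 h : g1 =O_ (nbhs (0 : R)) h -> g2 =O_ (nbhs (0 : R)) h ->
  (fun x => g1 x + g2 x) =O_ (nbhs (0 : R)) h.
Proof.
move=> /eqO_exP[k1 k10 H1] /eqO_exP[k2 k20 H2]; apply/eqO_exP.
exists (k1 + k2); first exact: addr_gt0.
apply: filterS2 H1 H2 => x H1 H2; rewrite mulrDl.
by apply: le_trans (ler_normD _ _) _; exact: lerD.
Qed.

Lemma eqO_mul g1 g2 h1 h2 :
  g1 =O_ (nbhs (0 : R)) h1 -> g2 =O_ (nbhs (0 : R)) h2 ->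
  (fun x => g1 x * g2 x) =O_ (nbhs (0 : R)) (fun x => h1 x * h2 x).
Proof.
move=> /eqO_exP[k1 k10 H1] /eqO_exP[k2 k20 H2]; apply/eqO_exP.
exists (k1 * k2); first exact: mulr_gt0.
apply: filterS2 H1 H2 => x H1 H2.
by rewrite !normrM mulrACA; exact: ler_pM.
Qed.

Lemma eqO_cmul (a : R) g h : g =O_ (nbhs (0 : R)) h ->
  (fun x => a * g x) =O_ (nbhs (0 : R)) h.
Proof.
move=> /eqO_exP[k k0 H]; apply/eqO_exP.
exists ((`|a| + 1) * k); first by rewrite mulr_gt0 // ltr_wpDl.
apply: filterS H => x H; rewrite normrM -mulrA.
by apply: ler_pM => //; rewrite lerDl.
Qed.

(** Near 0 one has [|x| < 1], where higher powers are smaller. *)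
Lemma eqO_exp_le (V : normedModType R) (g : R -> V) m n : (m <= n)%N ->
  g =O_ (nbhs (0 : R)) (fun x : R => x ^+ n) ->
  g =O_ (nbhs (0 : R)) (fun x : R => x ^+ m).
Proof.
move=> mn /eqO_exP[k k0 H]; apply/eqO_exP; exists k => //.
apply: filterS2 (nbhs0_lt (@ltr01 R)) H => x x1 H.
apply: le_trans H _; rewrite ler_wpM2l ?(ltW k0) // !normrX.
by apply: ler_wiXn2l => //; exact: ltW.
Qed.

(** The norm of a row is the maximum of its entries, and finitely many bounds valid for all large
    [k] share one [k]. *)
Lemma eqO_row d (g : R -> 'rV[R]_d) h :
  (forall a, (fun x => g x ord0 a) =O_ (nbhs (0 : R)) h) ->
  g =O_ (nbhs (0 : R)) h.
Proof.
move=> H; apply/eqOP.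
have : \forall k \near +oo, forall a, \forall x \near (0 : R),
    `|g x ord0 a| <= k * `|h x|.
  by apply: filter_forall => a; exact: (eqO_bigO (H a)).
move=> Hk; near=> k.
have Ha : forall a, \forall x \near (0 : R), `|g x ord0 a| <= k * `|h x|.
  by near: k.
have {}Ha := filter_forall (nbhs_filter (0 : R)) Ha.
suff : \forall x \near (0 : R), `|g x| <= k * `|h x| by [].
apply: filterS Ha => x Hx.
rewrite [leLHS]/Num.Def.normr /= mx_normrE.
apply: bigmax_le => [|[i j] _ /=]; last by rewrite (ord1 i); exact: Hx.
(* The maximum starts from the base value 0, so the bound has to be nonnegative. *)
by apply: mulr_ge0 => //; near: k; exact: nbhs_pinfty_ge.
Unshelve. all: by end_near. Qed.

Lemma eqO_pair (V W : normedModType R) (g1 : R -> V) (g2 : R -> W) h :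
  g1 =O_ (nbhs (0 : R)) h -> g2 =O_ (nbhs (0 : R)) h ->
  (fun x => (g1 x, g2 x)) =O_ (nbhs (0 : R)) h.
Proof.
move=> /eqO_exP[k1 k10 H1] /eqO_exP[k2 k20 H2]; apply/eqO_exP.
exists (k1 + k2); first exact: addr_gt0.
apply: filterS2 H1 H2 => x H1 H2.
rewrite prod_normE /= ge_max; apply/andP; split.
  by apply: le_trans H1 _; rewrite ler_wpM2r // lerDl ltW.
by apply: le_trans H2 _; rewrite ler_wpM2r // lerDr ltW.
Qed.

(** With [L] a bound for the differential, a small increment [w] changes [g] by at most
    [(1 + L) * |w|], and here [w = k tau *: p] is O(tau). *)
Lemma eqO_increment (V : normedModType R) (g : V -> R) (x p : V) (k : R -> R) :
  differentiable g x -> k =O_ (nbhs (0 : R)) (fun tau : R => tau ^+ 1) ->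
  (fun tau => g (x + k tau *: p) - g x)
    =O_ (nbhs (0 : R)) (fun tau : R => tau ^+ 1).
Proof.
move=> dg /eqO_exP[C C0 kC].
have [delta delta0 rem] := differentiable_remainder dg ltr01.
have [L L0 lip] := linear_lipschitz (diff_continuous dg).
have D0 : 0 < C * (`|p| + 1) by rewrite mulr_gt0 // ltr_wpDl.
apply/eqO_exP; exists ((1 + L) * (C * (`|p| + 1))).
  by rewrite mulr_gt0 // addr_gt0.
have dD : 0 < delta / (C * (`|p| + 1)) by rewrite divr_gt0.
apply: filterS2 (nbhs0_lt dD) kC => tau taud kC.
have kp : `|k tau *: p| <= C * (`|p| + 1) * `|tau|.
  rewrite normrZ mulrAC; apply: ler_pM => //.
  by rewrite lerDl.
have kpd : `|k tau *: p| < delta.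
  by apply: le_lt_trans kp _; rewrite mulrC -ltr_pdivlMr.
have -> : g (x + k tau *: p) - g x =
    (g (x + k tau *: p) - g x - 'd g x (k tau *: p)) + 'd g x (k tau *: p).
  by rewrite subrK.
apply: le_trans (ler_normD _ _) _.
apply: le_trans (lerD (rem _ kpd) (lip _)) _.
by rewrite -mulrDl expr1 -mulrA ler_wpM2l // addr_ge0 // ltW.
Qed.

(** Starting the increment at the midpoint [t + tau / 2] costs only second order: subtract the
    expansions at [t] with steps [(2^-1 + r) * tau] and [2^-1 * tau]. *)
Lemma increment_taylor1 (g dg : R -> R) (t r : R) :
  (\forall s \near t, is_derive s (1 : R) g (dg s)) -> derivable dg t 1 ->
  (fun tau : R => g (t + tau / 2 + r * tau) - g (t + tau / 2) - r * tau * dg t)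
    =O_ (nbhs (0 : R)) (fun tau : R => tau ^+ 2).
Proof.
move=> gd ddg.
have H1 := taylor1_bigO (2^-1 + r) gd ddg.
have H2 := eqO_cmul (- 1) (taylor1_bigO 2^-1 gd ddg).
rewrite [X in X =O__ _](_ : _ = fun tau : R =>
  (g (t + (2^-1 + r) * tau) - g t - (2^-1 + r) * tau * dg t) +
  -1 * (g (t + 2^-1 * tau) - g t - 2^-1 * tau * dg t)); first exact: eqO_add.
apply/funext => tau.
have -> : t + tau / 2 + r * tau = t + (2^-1 + r) * tau by ring.
have -> : t + tau / 2 = t + 2^-1 * tau by ring.
by ring.
Qed.

End bigO_algebra.

Lemma eqO_linear_part (R : realType) (k : R -> R) (k' : R) :
  (fun tau => k tau - tau * k') =O_ (nbhs (0 : R)) (fun tau : R => tau ^+ 2) ->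
  k =O_ (nbhs (0 : R)) (fun tau : R => tau ^+ 1).
Proof.
move=> kO.
rewrite [X in X =O__ _](_ : _ = fun tau => k tau - tau * k' + k' * tau).
  apply: eqO_add; first exact: eqO_exp_le kO.
  apply: eqO_cmul; apply/eqO_exP; exists 1 => //.
  by apply: nearW => tau; rewrite expr1 mul1r.
by apply/funext => tau; rewrite [k' * _]mulrC subrK.
Qed.

Section local_error.
Context (R : realType) (d : nat) (f : 'rV[R]_d -> R) (x y : 'rV[R]_d).
Context (z : R -> phase R d) (k b l v : R -> R) (k' v' : R).
Hypothesis f_smooth : smooth f.

(* Both splittings send [(x, y)] to
   [(x + l y + b grad f (x + k y), y + v grad f (x + k y))]. *)
Lemma local_error :
  (forall a, (fun tau => (z tau).1 ord0 a - x ord0 a - tau * (k' * y ord0 a))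
    =O_ (nbhs (0 : R)) (fun tau : R => tau ^+ 2)) ->
  (forall a, (fun tau => (z tau).2 ord0 a - y ord0 a
      - tau * (v' * partial a f x))
    =O_ (nbhs (0 : R)) (fun tau : R => tau ^+ 2)) ->
  k =O_ (nbhs (0 : R)) (fun tau : R => tau ^+ 1) ->
  b =O_ (nbhs (0 : R)) (fun tau : R => tau ^+ 2) ->
  (fun tau => l tau - tau * k') =O_ (nbhs (0 : R)) (fun tau : R => tau ^+ 2) ->
  (fun tau => v tau - tau * v') =O_ (nbhs (0 : R)) (fun tau : R => tau ^+ 2) ->
  (fun tau => z tau - (x + l tau *: y + b tau *: gradient f (x + k tau *: y),
                       y + v tau *: gradient f (x + k tau *: y)))
    =O_ (nbhs (0 : R)) (fun tau : R => tau ^+ 2).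
Proof.
move=> zq zp kO bO lO vO.
have gO a := eqO_increment y
  (smooth_differentiable x (smooth_partial a f_smooth)) kO.
have O1 (c : R) : (fun _ : R => c) =O_ (nbhs (0 : R)) (fun tau : R => tau ^+ 0).
  apply/eqO_exP; exists (`|c| + 1); first by rewrite ltr_wpDl.
  by apply: nearW => tau; rewrite expr0 normr1 mulr1 lerDl.
(* The gradient at the drifted point stays bounded, so this term inherits the order of [b]. *)
have bgO a : (fun tau => b tau * partial a f (x + k tau *: y))
    =O_ (nbhs (0 : R)) (fun tau : R => tau ^+ 2).
  rewrite [X in _ =O__ X](_ : _ = fun tau : R => tau ^+ 2 * tau ^+ 0); last first.
    by apply/funext => tau; rewrite expr0 mulr1.
  apply: eqO_mul bO _.
  rewrite [X in X =O__ _](_ : _ = fun tau => partial a f (x + k tau *: y)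
      - partial a f x + partial a f x); last by apply/funext => tau; rewrite subrK.
  by apply: eqO_add (O1 _); exact: eqO_exp_le (gO a).
(* Replacing the drifted point by [x] in the kick costs a product of two O(tau) factors. *)
have vgO a : (fun tau => v tau * (partial a f (x + k tau *: y) - partial a f x))
    =O_ (nbhs (0 : R)) (fun tau : R => tau ^+ 2).
  exact: eqO_mul (eqO_linear_part vO) (gO a).
rewrite [X in X =O__ _](_ : _ = fun tau =>
  ((z tau).1 - (x + l tau *: y + b tau *: gradient f (x + k tau *: y)),
   (z tau).2 - (y + v tau *: gradient f (x + k tau *: y)))); last first.
  by apply/funext => tau; case: (z tau).
apply: eqO_pair; apply: eqO_row => a.
  rewrite [X in X =O__ _](_ : _ = fun tau =>
     ((z tau).1 ord0 a - x ord0 a - tau * (k' * y ord0 a)) +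
     (- y ord0 a * (l tau - tau * k') +
      -1 * (b tau * partial a f (x + k tau *: y)))).
    by apply: eqO_add (zq a) _; apply: eqO_add; exact: eqO_cmul.
  apply/funext => tau; rewrite !mxE.
  by move: (partial a f _) => w; ring.
rewrite [X in X =O__ _](_ : _ = fun tau =>
   ((z tau).2 ord0 a - y ord0 a - tau * (v' * partial a f x)) +
   (- partial a f x * (v tau - tau * v') +
    -1 * (v tau * (partial a f (x + k tau *: y) - partial a f x)))).
  by apply: eqO_add (zp a) _; apply: eqO_add; exact: eqO_cmul.
apply/funext => tau; rewrite !mxE.
by move: (partial a f _) (partial a f _) => w w'; ring.
Qed.

End local_error.

(** * First-order expansion of exact solutions *)

Section solution_taylor.
Context (R : realType) (d : nat) (sigma c : R) (f : 'rV[R]_d -> R).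
Context (J : set R) (z : R -> phase R d).
Hypotheses (c_neq0 : c != 0) (f_smooth : smooth f).
Hypotheses (J_open : open J) (J_gt0 : J `<=` [set t | 0 < t]).
Hypothesis sol : canonical_solution (HZ sigma c f) J z.

Let eqs := canonical_solution_HZ c_neq0
  (fun x => smooth_differentiable x f_smooth) J_gt0 sol.

Lemma position_taylor1 (t : R) (a : 'I_d) : J t ->
  (fun tau : R => (z (t + tau)).1 ord0 a - (z t).1 ord0 a
      - tau * (drift_rate sigma c t * (z t).2 ord0 a))
    =O_ (nbhs (0 : R)) (fun tau : R => tau ^+ 2).
Proof.
move=> Jt; have t0 : 0 < t := J_gt0 Jt.
pose dq s := drift_rate sigma c s * (z s).2 ord0 a.
have qd : \forall s \near t,
    is_derive s (1 : R) (fun r => (z r).1 ord0 a) (dq s).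
  near=> s; have Js : J s by near: s; exact: open_nbhs_nbhs.
  by have [] := eqs Js a.
have [_ dp] := eqs Jt a.
have [ddq _] := is_deriveM (is_derive_drift_rate sigma c t0) dp.
have := taylor1_bigO 1 qd ddq.
rewrite [X in X =O__ _ -> _](_ : _ = fun tau : R => (z (t + tau)).1 ord0 a
  - (z t).1 ord0 a - tau * (drift_rate sigma c t * (z t).2 ord0 a)) //.
by apply/funext => tau; rewrite mul1r.
Unshelve. all: by end_near. Qed.

Lemma momentum_taylor1 (t : R) (a : 'I_d) : J t ->
  (fun tau : R => (z (t + tau)).2 ord0 a - (z t).2 ord0 a
      - tau * (kick_rate sigma c t * partial a f (z t).1))
    =O_ (nbhs (0 : R)) (fun tau : R => tau ^+ 2).
Proof.
move=> Jt; have t0 : 0 < t := J_gt0 Jt.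
pose dp s := kick_rate sigma c s * partial a f (z s).1.
have pd : \forall s \near t,
    is_derive s (1 : R) (fun r => (z r).2 ord0 a) (dp s).
  near=> s; have Js : J s by near: s; exact: open_nbhs_nbhs.
  by have [] := eqs Js a.
(* The canonical equations give coordinatewise derivatives; they are assembled into one
   differentiable curve so that the chain rule with [partial a f] applies. *)
have dq : differentiable (fun s => (z s).1) t.
  apply/derivable1_diffP/derivable_mxP => i b; rewrite (ord1 i).
  by have [[]] := eqs Jt b.
have dg : derivable (partial a f \o (fun s => (z s).1)) t 1.
  apply/derivable1_diffP; apply: differentiable_comp => //.
  exact/smooth_differentiable/smooth_partial.
have ddp : derivable dp t 1.
  have -> : dp = kick_rate sigma c * (partial a f \o (fun s => (z s).1)) by [].
  exact: (derivableM (derivable_kick_rate t0) dg).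
have := taylor1_bigO 1 pd ddp.
rewrite [X in X =O__ _ -> _](_ : _ = fun tau : R => (z (t + tau)).2 ord0 a
  - (z t).2 ord0 a - tau * (kick_rate sigma c t * partial a f (z t).1)) //.
by apply/funext => tau; rewrite mul1r.
Unshelve. all: by end_near. Qed.

End solution_taylor.

(** * The splittings as drifts and kicks, and their local errors *)

Definition drift_coef (R : realType) (sigma c s h : R) : R :=
  ((s + h) `^ (- (2 * sigma)) - s `^ (- (2 * sigma))) / (2 * sigma * c).

Definition kick_coef (R : realType) (sigma c s h : R) : R :=
  sigma * c / 3 * ((s + h) `^ (3 * sigma) - s `^ (3 * sigma)).

(** The half step in time acts first, so the coefficients start at [t + tau / 2]. *)
Lemma Phi1E (R : realType) (d : nat) (sigma c : R) (f : 'rV[R]_d -> R)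
    (tau t : R) (z : phase R d) :
  Phi1 sigma c f tau (z, t) =
    (kick f (kick_coef sigma c (t + tau / 2) tau)
       (drift (drift_coef sigma c (t + tau / 2) tau) z), t + tau / 2 + tau / 2).
Proof. by case: z. Qed.

Lemma Phi2E (R : realType) (d : nat) (sigma c : R) (f : 'rV[R]_d -> R)
    (tau t : R) (z : phase R d) :
  Phi2 sigma c f tau (z, t) =
    (drift (drift_coef sigma c (t + tau / 2) (tau / 2))
       (kick f (kick_coef sigma c (t + tau / 2) tau)
         (drift (drift_coef sigma c (t + tau / 2) (tau / 2)) z)),
     t + tau / 2 + tau / 2).
Proof. by case: z. Qed.

(** The factor [r] is 1 for the full drift of [Phi1] and [2^-1] for the half drifts of [Phi2]. *)
Lemma drift_coef_taylor1 (R : realType) (sigma c t r : R) :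
  c != 0 -> sigma != 0 -> 0 < t ->
  (fun tau => drift_coef sigma c (t + tau / 2) (r * tau)
      - r * tau * drift_rate sigma c t)
    =O_ (nbhs (0 : R)) (fun tau : R => tau ^+ 2).
Proof.
move=> c0 s0 t0.
have dK : \forall s \near t, is_derive s (1 : R)
    (fun s => s `^ (- (2 * sigma)) / (2 * sigma * c)) (drift_rate sigma c s).
  near=> s; apply: is_derive_drift_primitive => //.
  by near: s; exact: lt_nbhsr.
have [ddr _] := is_derive_drift_rate sigma c t0.
have := increment_taylor1 r dK ddr.
rewrite [X in X =O__ _ -> _](_ : _ = fun tau : R =>
  drift_coef sigma c (t + tau / 2) (r * tau)
      - r * tau * drift_rate sigma c t) //.
by apply/funext => tau; rewrite /drift_coef mulrBl.
Unshelve. all: by end_near. Qed.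

Lemma kick_coef_taylor1 (R : realType) (sigma c t : R) : 0 < t ->
  (fun tau => kick_coef sigma c (t + tau / 2) tau - tau * kick_rate sigma c t)
    =O_ (nbhs (0 : R)) (fun tau : R => tau ^+ 2).
Proof.
move=> t0.
have dV : \forall s \near t, is_derive s (1 : R)
    (fun s => sigma * c / 3 * s `^ (3 * sigma)) (kick_rate sigma c s).
  near=> s; apply: is_derive_kick_primitive => //.
  by near: s; exact: lt_nbhsr.
have := increment_taylor1 1 dV (derivable_kick_rate t0).
rewrite [X in X =O__ _ -> _](_ : _ = fun tau : R =>
  kick_coef sigma c (t + tau / 2) tau - tau * kick_rate sigma c t) //.
by apply/funext => tau; rewrite /kick_coef mul1r mulrBr.
Unshelve. all: by end_near. Qed.

Section splitting_errors.
Context (R : realType) (d : nat) (sigma c : R) (f : 'rV[R]_d -> R).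
Context (J : set R) (z : R -> phase R d) (t : R).
Hypotheses (c_neq0 : c != 0) (sigma_neq0 : sigma != 0) (f_smooth : smooth f).
Hypotheses (J_open : open J) (J_gt0 : J `<=` [set t | 0 < t]).
Hypotheses (sol : canonical_solution (HZ sigma c f) J z) (Jt : J t).

Let zq a := position_taylor1 c_neq0 f_smooth J_open J_gt0 sol a Jt.
Let zp a := momentum_taylor1 c_neq0 f_smooth J_open J_gt0 sol a Jt.

Lemma Phi1_error :
  (fun tau : R => z (t + tau) - (Phi1 sigma c f tau (z t, t)).1)
    =O_ (nbhs (0 : R)) (fun tau : R => tau ^+ 2).
Proof.
have t0 : 0 < t := J_gt0 Jt.
pose k tau := drift_coef sigma c (t + tau / 2) tau.
have kO : (fun tau => k tau - tau * drift_rate sigma c t)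
    =O_ (nbhs (0 : R)) (fun tau : R => tau ^+ 2).
  have := drift_coef_taylor1 1 c_neq0 sigma_neq0 t0.
  rewrite [X in X =O__ _ -> _](_ : _ = fun tau =>
    k tau - tau * drift_rate sigma c t) //.
  by apply/funext => tau; rewrite mul1r.
(* No drift follows the kick in [Phi1], so the gradient does not enter the position: [b = 0] and
   [l = k]. *)
have b0 : (fun _ : R => 0 : R) =O_ (nbhs (0 : R)) (fun tau : R => tau ^+ 2).
  apply/eqO_exP; exists 1 => //.
  by apply: nearW => tau; rewrite normr0 mul1r.
have := local_error (z := fun tau => z (t + tau)) f_smooth zq zp
  (eqO_linear_part kO) b0 kO (kick_coef_taylor1 sigma c t0).
rewrite [X in X =O__ _ -> _](_ : _ = fun tau =>
  z (t + tau) - (Phi1 sigma c f tau (z t, t)).1) //.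
by apply/funext => tau; rewrite Phi1E scale0r addr0.
Qed.

Lemma Phi2_error :
  (fun tau : R => z (t + tau) - (Phi2 sigma c f tau (z t, t)).1)
    =O_ (nbhs (0 : R)) (fun tau : R => tau ^+ 2).
Proof.
have t0 : 0 < t := J_gt0 Jt.
pose k tau := drift_coef sigma c (t + tau / 2) (tau / 2).
pose v tau := kick_coef sigma c (t + tau / 2) tau.
have kO : (fun tau => k tau - tau * (drift_rate sigma c t / 2))
    =O_ (nbhs (0 : R)) (fun tau : R => tau ^+ 2).
  have := drift_coef_taylor1 2^-1 c_neq0 sigma_neq0 t0.
  rewrite [X in X =O__ _ -> _](_ : _ = fun tau =>
    k tau - tau * (drift_rate sigma c t / 2)) //.
  by apply/funext => tau; rewrite /k [2^-1 * tau]mulrC -mulrA [2^-1 * _]mulrC.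
(* The two half drifts together move the position by [2 * k tau] times the initial momentum. *)
have lO : (fun tau => 2 * k tau - tau * drift_rate sigma c t)
    =O_ (nbhs (0 : R)) (fun tau : R => tau ^+ 2).
  have := eqO_cmul 2 kO.
  rewrite [X in X =O__ _ -> _](_ : _ = fun tau =>
    2 * k tau - tau * drift_rate sigma c t) //.
  apply/funext => tau; move: (k tau) (drift_rate _ _ _) => w w'.
  by field.
have vO : (fun tau => v tau - tau * kick_rate sigma c t)
    =O_ (nbhs (0 : R)) (fun tau : R => tau ^+ 2).
  exact: kick_coef_taylor1.
(* The second half drift carries the kick into the position with coefficient [k tau * v tau], a
   product of two O(tau) factors. *)
have bO : (fun tau => k tau * v tau)
    =O_ (nbhs (0 : R)) (fun tau : R => tau ^+ 2).
  exact: eqO_mul (eqO_linear_part kO) (eqO_linear_part vO).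
have := local_error (z := fun tau => z (t + tau)) f_smooth zq zp
  (eqO_linear_part kO) bO lO vO.
rewrite [X in X =O__ _ -> _](_ : _ = fun tau =>
  z (t + tau) - (Phi2 sigma c f tau (z t, t)).1) //.
apply/funext => tau; rewrite Phi2E /drift /kick /= -/(k tau) -/(v tau).
by rewrite scalerDr scalerA addrA mulr_natl mulr2n scalerDl addrA.
Qed.

End splitting_errors.

Unset Implicit Arguments.

Theorem theorem3p1 (R : realType) (d : nat) (sigma c : R) (f : 'rV[R]_d -> R)
    (d_ge1 : (1 <= d)%N) (sigma_ge2 : 2 <= sigma) (c_neq0 : c != 0)
    (f_smooth : smooth f) :
  [/\ forall (J : set R) (z : R -> phase R d),
        open J -> is_interval J -> J `<=` [set t | 0 < t] ->
        canonical_solution (HZ sigma c f) J z ->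
        forall (a : 'I_d) (t : R), J t ->
          let q_a : R -> R := fun s => (z s).1 ord0 a in
          derivable (q_a^`()%classic) t 1 /\
          (q_a^`()^`()%classic) t + (2 * sigma + 1) / t * (q_a^`()%classic) t
            + sigma ^+ 2 * t `^ (sigma - 2) * partial a f (z t).1 = 0,
      symplectic_integrator 1 [set t | 0 < t] (HZ sigma c f) (Phi1 sigma c f)
    & symplectic_integrator 2 [set t | 0 < t] (HZ sigma c f) (Phi2 sigma c f)].
Proof.
(* Together with [c != 0] this makes the denominator [2 * sigma * c] of the drift invertible. *)
have sigma_neq0 : sigma != 0 by rewrite gt_eqF // (lt_le_trans _ sigma_ge2).
split.
- move=> J z Jo _ J0 sol a t Jt.
  exact: (second_order_equation c_neq0 f_smooth Jo J0 sol a Jt).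
- split=> [t tau z _ _|J z Jo _ J0 sol t Jt|t tau _ _].
  + by rewrite Phi1E -addrA -splitr.
  (* The O(tau^2) estimate for [Phi1] is weakened to the O(tau) of a first-order integrator. *)
  + apply: (@eqO_exp_le _ _ _ 1 2) => //.
    exact: (Phi1_error c_neq0 sigma_neq0 f_smooth Jo J0 sol Jt).
  + rewrite (_ : (fun z => _) = kick f (kick_coef sigma c (t + tau / 2) tau)
      \o drift (drift_coef sigma c (t + tau / 2) tau)); last first.
      by apply/funext => z; rewrite Phi1E.
    apply: preserves_omega_comp; first exact: preserves_omega_drift.
    exact: preserves_omega_kick.
- split=> [t tau z _ _|J z Jo _ J0 sol t Jt|t tau _ _].
  + by rewrite Phi2E -addrA -splitr.
  + exact: (Phi2_error c_neq0 sigma_neq0 f_smooth Jo J0 sol Jt).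
  + rewrite (_ : (fun z => _) =
      drift (drift_coef sigma c (t + tau / 2) (tau / 2)) \o
      (kick f (kick_coef sigma c (t + tau / 2) tau)
      \o drift (drift_coef sigma c (t + tau / 2) (tau / 2)))); last first.
      by apply/funext => z; rewrite Phi2E.
    apply: preserves_omega_comp; last exact: preserves_omega_drift.
    apply: preserves_omega_comp; first exact: preserves_omega_drift.
    exact: preserves_omega_kick.
Qed.
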